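(* Let $\mathfrak g$ be a solvable Lie algebra, $\mathcal X:=\mathfrak g^n$, $\mathcal W:=\mathfrak g^r$ with $n,r\ge1$. Consider the dynamics $X^+=f(X,W)$, where $f:\mathcal X\times\mathcal W\to\mathcal X$ is a Lie function with linear part $A:\mathcal X\to\mathcal X$ in the state, such that: (i) the origin of $\mathcal X$ is the unique equilibrium, i.e. for $X\in\mathcal X$, $f(X,W)=X$ for all $W\in\mathcal W$ if and only if $X=0$; (ii) there is a nilpotent ideal $\mathfrak h\subseteq\mathfrak g$ with $\mathfrak h\supseteq[\mathfrak g,\mathfrak g]$ such that $f\big((\mathfrak h^{(i)})^n,\mathcal W\big)\subseteq(\mathfrak h^{(i)})^n$ for every ideal $\mathfrak h^{(i)}$ of the lower central series of $\mathfrak h$. If $\rho(A)=0$ and $W[k]\in\mathfrak h^r$ for all $k\ge0$, then $X$ converges to zero in finite time.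
   Context: All vector spaces are finite dimensional over $\mathbb F\in\{\mathbb R,\mathbb C\}$. $\rho$ denotes spectral radius. Lower central series of $\mathfrak h$: $\mathfrak h^{(1)}:=\mathfrak h$, $\mathfrak h^{(i+1)}:=[\mathfrak h^{(i)},\mathfrak h]$; $\mathfrak h$ is nilpotent if $\mathfrak h^{(p+1)}=0$ for some finite $p$. $\mathfrak g$ is solvable if its derived series $\mathfrak g_0=\mathfrak g$, $\mathfrak g_{i+1}=[\mathfrak g_i,\mathfrak g_i]$ reaches $0$. System: $X^+=f(X,W)$ means $X[k+1]=f(X[k],W[k])$, $k\ge0$, with state $X=(X_1,\dots,X_n)\in\mathcal X$ and exogenous signal $W=(W_1,\dots,W_r)\in\mathcal W$ that does not depend on $X$. A word $\omega$ of length $|\omega|$ is a nested bracket $[Y_{\omega_1},[Y_{\omega_2},[\dots,Y_{\omega_{|\omega|}}]\cdots]$ with letters $Y_{\omega_j}$ in $\widetilde X\cup\widetilde W$, where $\widetilde X=\{X_1,\dots,X_n\}$ and $\widetilde W=\{W_1,\dots,W_r\}$. A Lie function is a function whose components are (possibly infinite) linear combinations of words in its arguments. Under the stated hypotheses the dynamics are written as $f(X,W)=AX+\sum_\omega c_\omega\otimes\omega$, where $A:\mathcal X\to\mathcal X$ is linear, the sum is over words of length at least $2$, every word has at least one letter in $\widetilde X$, and $c_\omega\in\mathbb F^n$ (with $\mathfrak g^n\cong\mathbb F^n\otimes\mathfrak g$). Convergence in finite time: there is a finite time $\bar k$ such that $X[k]=0$ for all $k\ge\bar k$. *)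

(* Defs.v *)
From HB Require Import structures.
From mathcomp Require Import all_boot all_order all_algebra finmap.
From mathcomp Require Import complex.
From mathcomp Require Import all_classical all_reals all_analysis.

Set Implicit Arguments.
Unset Strict Implicit.
Unset Printing Implicit Defensive.

Import Order.TTheory GRing.Theory Num.Theory.
Import numFieldNormedType.Exports.

Local Open Scope classical_set_scope.
Local Open Scope ring_scope.
Local Open Scope complex_scope.

Variant scalar_kind := Reals | Complexes.

Definition scalar_field (R : realType) (k : scalar_kind) : numFieldType :=
  match k with Reals => R | Complexes => R[i] end.

Definition scalar_to_complex (R : realType) (k : scalar_kind) :
    scalar_field R k -> R[i] :=
  match k with Reals => real_complex R | Complexes => id end.
Arguments scalar_to_complex : clear implicits.

(* For F = R the eigenvalues are those of the complexification; the set below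
   is finite, so its supremum is a maximum (and 0 when V is the zero space). *)
Definition spectral_radius (R : realType) (k : scalar_kind)
    (V : vectType (scalar_field R k)) (A : 'End(V)) : R :=
  let M := passmx.mxof (vbasis fullv) (vbasis fullv) A in
  sup [set Normc.normc z | z in [set z : R[i] |
    eigenvalue (map_mx (scalar_to_complex R k) M) z]].

HB.mixin Record Vector_isLieAlgebra (F : fieldType) g of Vector F g := {
  lie : g -> g -> g;
  lie_linearl : forall y, linear (lie^~ y);
  lie_linearr : forall x, linear (lie x);
  liexx : forall x, lie x x = 0;
  lie_jacobi : forall x y z,
    lie x (lie y z) + lie y (lie z x) + lie z (lie x y) = 0
}.

#[short(type="lieAlgType")]
HB.structure Definition LieAlgebra (F : fieldType) :=
  { g of Vector_isLieAlgebra F g & Vector F g }.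

Section Bilinear.
Variables (F : fieldType) (g : lieAlgType F).

HB.instance Definition _ (x : g) :=
  GRing.isLinear.Build F g g _ (lie x) (lie_linearr x).

Definition lier (y x : g) : g := lie x y.

HB.instance Definition _ (y : g) :=
  GRing.isLinear.Build F g g _ (lier y) (lie_linearl y).

End Bilinear.

Section Subspaces.
Variables (F : fieldType) (g : lieAlgType F).
Implicit Types U V T h : {vspace g}.

Definition lieV U V : {vspace g} :=
  <<[seq lie u v | u <- vbasis U, v <- vbasis V]>>%VS.

Lemma lieV_subP U V T :
  reflect (forall u v, u \in U -> v \in V -> lie u v \in T) (lieV U V <= T)%VS.
Proof.
apply: (iffP idP) => [/span_subvP sT u v uU vV | sT].
  rewrite (coord_vbasis uU) -[lie _ v]/(lier v _) linear_sum rpred_sum// => i _.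
  rewrite linearZ/= rpredZ// /lier (coord_vbasis vV) linear_sum rpred_sum//.
  move=> j _; rewrite linearZ/= rpredZ// sT//.
  by apply/allpairsP; exists ((vbasis U)`_i, (vbasis V)`_j);
    rewrite !mem_nth ?size_tuple.
apply/span_subvP => _ /allpairsP[[u v] /= [uU vV ->]].
by apply: sT; apply: vbasis_mem.
Qed.

Definition lie_ideal h : Prop := forall x y, y \in h -> lie x y \in h.

(* Zero-based: [lower_central h i] is the (i+1)-st term of the series. *)
Fixpoint lower_central h (i : nat) : {vspace g} :=
  if i is i'.+1 then lieV (lower_central h i') h else h.

Definition lie_nilpotent h : Prop := exists p, lower_central h p = 0%VS.

Fixpoint derived_series (i : nat) : {vspace g} :=
  if i is i'.+1 then lieV (derived_series i') (derived_series i') else fullv.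

Definition lie_solvable : Prop := exists p, derived_series p = 0%VS.

End Subspaces.
Arguments lie_solvable {F} g.

Section LieFunctions.
Variables (F : numFieldType) (g : lieAlgType F) (n r : nat).

(* [vectType] carries no topology; a finite-dimensional space over R or C has
   a unique Hausdorff vector space topology, that of the coordinates. *)
Definition cvg_coord (u : nat -> g) (l : g) : Prop :=
  forall j, (coord (vbasis fullv) j (u N) : F) @[N --> \oo] -->
            (coord (vbasis fullv) j l : F).

(* [inl j] stands for the letter X_j and [inr j] for W_j. *)
Definition letter : choiceType := ('I_n + 'I_r)%type.

Definition letter_eval (X : {ffun 'I_n -> g}) (W : {ffun 'I_r -> g})
    (l : letter) : g :=
  match l with inl j => X j | inr j => W j end.

(* Words are nonempty; the empty sequence contributes 0 to every sum. *)
Fixpoint word_eval (Y : letter -> g) (w : seq letter) : g :=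
  match w with
  | [::] => 0
  | [:: l] => Y l
  | l :: w' => lie (Y l) (word_eval Y w')
  end.

(* phi(X, W) is the sum of the c w *: w over all words w. The sum is taken
   along some increasing exhaustion of the countable set of words by finite
   sets; this covers unconditional summation, any enumeration of the words,
   and summation of the homogeneous parts in order of increasing length. *)
Definition lie_combination (c : seq letter -> F)
    (phi : {ffun 'I_n -> g} -> {ffun 'I_r -> g} -> g) : Prop :=
  exists S : nat -> {fset seq letter},
    [/\ forall N M, (N <= M)%N -> (S N `<=` S M)%fset,
        forall w, exists N, w \in S N &
        forall X W,
          cvg_coord
            (fun N => \sum_(w <- S N) c w *: word_eval (letter_eval X W) w)
            (phi X W)].

Definition lie_function (c : seq letter -> {ffun 'I_n -> F})
    (f : {ffun 'I_n -> g} -> {ffun 'I_r -> g} -> {ffun 'I_n -> g}) : Prop :=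
  forall i, lie_combination (fun w => c w i) (fun X W => f X W i).

(* The contribution of the words of length one with a letter in X. *)
Definition state_linear_fun (c : seq letter -> {ffun 'I_n -> F})
    (X : {ffun 'I_n -> g}) : {ffun 'I_n -> g} :=
  [ffun i => \sum_(j < n) c [:: inl j] i *: X j].

Lemma state_linear_fun_linear c : linear (state_linear_fun c).
Proof.
move=> a x y; apply/ffunP => i; rewrite !ffunE scaler_sumr -big_split /=.
by apply: eq_bigr => j _; rewrite !ffunE scalerDr !scalerA mulrC.
Qed.

HB.instance Definition _ c :=
  GRing.isLinear.Build F {ffun 'I_n -> g} {ffun 'I_n -> g} _
    (state_linear_fun c) (state_linear_fun_linear c).

Definition state_linear_part (c : seq letter -> {ffun 'I_n -> F}) :
    'End({ffun 'I_n -> g}) := linfun (state_linear_fun c).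

End LieFunctions.
Arguments state_linear_part {F} g {n r} c.

(* Main.v *)
Require Import Defs.
From HB Require Import structures.
From mathcomp Require Import all_boot all_order all_algebra finmap.
From mathcomp Require Import complex.
From mathcomp Require Import all_classical all_reals all_analysis.
Import Order.TTheory GRing.Theory Num.Theory.
Local Open Scope ring_scope.

(** Write [A] for the linear part of [f] in the state. The equilibrium
    condition at [0] says [f 0 w = 0] for every [w], so [f x w] is the limit of
    the sums of the differences [v(x, w) - v(0, w)] over the words [v]; passing
    to differences removes all words in the exogenous letters alone.

    Suppose that the state lies in a subspace [U], that all letters lie in a
    Lie subalgebra [B] containing [U], and that [T], contained in [U], contains
    [[U, B]]. Every difference of a word of length at least two then lies in
    [T] ([word_eval_diff_mem]), and subspaces are closed under coordinatewise
    limits ([cvg_coord_coset]). Hence [f x w] and [A x] agree modulo [T]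
    ([lie_function_linear_mod]): modulo [T] the dynamics is linear and no
    longer depends on the input.

    A spectral radius equal to zero makes [A] nilpotent
    ([spectral_radius0_nilpotent]), say [A ^ d = 0], so a state that starts in
    [U] is in [T] after [d] steps ([nilpotent_mod_reach]). Taking first
    [U = B = g] and [T = h], which contains [[g, g]], and then [B = h] with [U]
    and [T] consecutive terms of the lower central series of [h], the state
    descends that series, [d] steps per term, and reaches [0]. There it stays,
    since [f 0 w = 0]. *)

(** * Differences of words *)

Lemma lie_anti (F : fieldType) (g : lieAlgType F) (x y : g) :
  lie x y = - lie y x.
Proof.
apply/eqP; rewrite -addr_eq0; apply/eqP.
have := liexx (x + y); rewrite linearD/= -!/(lier _ (x + y)) !linearD /lier.
by rewrite /= /lier !liexx add0r addr0 addrC.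
Qed.

Section Words.
Context {F : numFieldType} {g : lieAlgType F} {n r : nat}.
Implicit Types (B U T : {vspace g}) (Y : letter n r -> g).

Lemma word_eval_mem B Y (w : seq (letter n r)) :
  (lieV B B <= B)%VS -> (forall l, Y l \in B) -> word_eval Y w \in B.
Proof.
move=> /lieV_subP BB YB; elim: w => [|l [|l' w] IH] /=; first exact: mem0v.
  exact: YB.
exact: BB.
Qed.

Lemma word_eval_cons Y l (w : seq (letter n r)) :
  (0 < size w)%N -> word_eval Y (l :: w) = lie (Y l) (word_eval Y w).
Proof. by case: w. Qed.

(** A difference of brackets telescopes into
    [lie (x - x') y + lie x' (y - y')], and both summands are in [[U, B]]. *)
Lemma lie_diff_mem {B U T} {x x' y y' : g} :
  (lieV U B <= T)%VS -> x' \in B -> y \in B -> x - x' \in U -> y - y' \in U ->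
  lie x y - lie x' y' \in T.
Proof.
move=> /lieV_subP UBT x'B yB xx' yy'.
have -> : lie x y - lie x' y' = lie (x - x') y + lie x' (y - y').
  rewrite linearB/= -/(lier y (x - x')) linearB /lier/=.
  by rewrite addrA subrK.
by apply: rpredD; [exact: UBT | rewrite lie_anti rpredN; exact: UBT].
Qed.

(** Two evaluations that agree modulo [U] on the letters agree modulo [U] on
    every word, by telescoping; the outermost bracket of a word of length at
    least two then pushes the difference into [[U, B]]. *)
Lemma word_eval_diff_mem B U T Y Y' (w : seq (letter n r)) :
    (lieV B B <= B)%VS -> (T <= U)%VS -> (lieV U B <= T)%VS ->
    (forall l, Y l \in B) -> (forall l, Y' l \in B) ->
    (forall l, Y l - Y' l \in U) ->
  (1 < size w)%N -> word_eval Y w - word_eval Y' w \in T.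
Proof.
move=> BB TU UBT YB Y'B YY'; case: w => [//|l w] w0.
have {}w0 : (0 < size w)%N by [].
suff wU : word_eval Y w - word_eval Y' w \in U.
  rewrite !word_eval_cons//; apply: lie_diff_mem UBT _ _ _ _ => //.
  exact: word_eval_mem.
elim: w w0 {l} => // l [_ _|l' w IH _]; first exact: YY'.
have {}IH := IH isT; apply: (subvP TU).
rewrite (word_eval_cons Y)// (word_eval_cons Y')//.
apply: lie_diff_mem UBT _ _ _ _ => //.
exact: word_eval_mem.
Qed.

End Words.

(** * Coordinatewise limits in finite dimension *)

Section Limits.
Import numFieldNormedType.Exports.
Context {F : numFieldType} {g : lieAlgType F}.
Implicit Types (T : {vspace g}) (u : nat -> g).
Local Open Scope classical_set_scope.

Lemma cvg_coordB u v a b : cvg_coord u a -> cvg_coord v b ->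
  cvg_coord (fun N => u N - v N) (a - b).
Proof.
move=> ua vb j; rewrite linearB/=.
under eq_fun do rewrite linearB/=.
by apply: cvgB; [exact: ua | exact: vb].
Qed.

Lemma cvg_coord_linear (phi : 'End(g)) u a :
  cvg_coord u a -> cvg_coord (fun N => phi (u N)) (phi a).
Proof.
move=> ua j; set e := vbasis fullv.
have E v : coord e j (phi v) =
    \sum_(i < \dim {:g}) coord e i v * coord e j (phi e`_i).
  rewrite {1}(coord_vbasis (memvf v)) !linear_sum/=.
  by apply: eq_bigr => i _; rewrite !linearZ.
rewrite E; under eq_fun do rewrite E.
apply: cvg_big => [|i _]; first exact: add_continuous.
by apply: cvgMr_tmp; exact: ua.
Qed.

Lemma cvg_coord_eq_near u a b (N0 : nat) :
  cvg_coord u a -> (forall N, (N0 <= N)%N -> u N = b) -> a = b.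
Proof.
move=> ua ub; rewrite (coord_vbasis (memvf a)) (coord_vbasis (memvf b)).
apply: eq_bigr => j _; congr (_ *: _).
have vb : (coord (vbasis fullv) j (u N) : F) @[N --> \oo] -->
    (coord (vbasis fullv) j b : F).
  by apply: cvg_near_cst; exists N0 => // N /= N0N; rewrite ub.
exact: (cvg_unique _ (ua j) vb).
Qed.

(** Subspaces are closed: [T] is the kernel of the linear map [\1 - projv T],
    and linear maps are continuous. *)
Lemma cvg_coord_coset T u l a (N0 : nat) : cvg_coord u l ->
  (forall N, (N0 <= N)%N -> u N - a \in T) -> l - a \in T.
Proof.
move=> ul uT.
pose phi : 'End(g) := (\1 - projv T)%VF.
have phiT v : (v \in T) = (phi v == 0).
  rewrite /phi add_lfunE opp_lfunE id_lfunE subr_eq0.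
  apply/idP/eqP => [/projv_id //|->]; exact: memv_proj.
rewrite phiT linearB subr_eq0/=; apply/eqP.
apply: (cvg_coord_eq_near _ _ _ N0 (cvg_coord_linear phi _ _ ul)) => N /uT.
by rewrite phiT linearB subr_eq0 => /eqP.
Qed.

End Limits.

(** * A zero spectral radius forces nilpotency *)

Section Nilpotency.

(** Over an algebraically closed extension the characteristic polynomial splits
    into factors ['X - 0], so it is a power of ['X], already over [F] because
    field morphisms are injective; Cayley-Hamilton concludes. *)
Lemma eigenvalue0_nilpotent (F : fieldType) (C : closedFieldType)
    (sigma : {rmorphism F -> C}) m (M : 'M[F]_m) :
  (forall z, eigenvalue (map_mx sigma M) z -> z = 0) -> exists d, M ^+ d = 0.
Proof.
case: m M => [|m] M eig0; first by exists 0%N; exact: flatmx0.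
have [rs rsE] := closed_field_poly_normal (char_poly (map_mx sigma M)).
rewrite (monicP (char_poly_monic _)) scale1r in rsE.
have rs0 z : z \in rs -> z = 0.
  by move=> zrs; apply: eig0; rewrite eigenvalue_root_char rsE root_prod_XsubC.
have charM : char_poly M = 'X^(size rs).
  apply: (map_poly_inj sigma); rewrite map_polyXn map_char_poly rsE.
  rewrite (eq_big_seq (fun=> 'X)); last by move=> z /rs0 ->; rewrite subr0.
  by rewrite big_const_seq count_predT iter_mulr_1.
exists (size rs); rewrite -[M]horner_mx_X -rmorphXn/= -charM.
exact: Cayley_Hamilton.
Qed.

Context {R : realType}.

Lemma normc_ge0 (z : R[i]) : 0 <= Normc.normc z.
Proof. by case: z => a b; exact: sqrtr_ge0. Qed.

(** As a supremum in the reals bounds its set only when that set has an upper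
    bound, one is provided: the sum of the moduli of the roots of the
    characteristic polynomial. *)
Lemma spectral_radius_ub k (V : vectType (scalar_field R k)) (A : 'End(V)) z :
  eigenvalue (map_mx (scalar_to_complex R k)
    (passmx.mxof (vbasis fullv) (vbasis fullv) A)) z ->
  Normc.normc z <= spectral_radius A.
Proof.
move=> eigz; apply: ub_le_sup; last by exists z.
set M := map_mx _ _ in eigz *.
have [rs rsE] := closed_field_poly_normal (char_poly M).
rewrite (monicP (char_poly_monic _)) scale1r in rsE.
exists (\sum_(x <- rs) Normc.normc x) => _ [x /= eigx <-].
have xrs : x \in rs by rewrite -root_prod_XsubC -rsE -eigenvalue_root_char.
rewrite (big_rem x)//= lerDl sumr_ge0// => y _; exact: normc_ge0.
Qed.

Lemma spectral_radius0_nilpotent k (V : vectType (scalar_field R k))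
    (A : 'End(V)) :
  spectral_radius A = 0 -> exists d, forall v, iter d A v = 0.
Proof.
move=> rho0; pose e := vbasis {:V}.
have eB : basis_of {:V} e := vbasisP _.
set M := passmx.mxof e e A.
have eig0 z : eigenvalue (map_mx (scalar_to_complex R k) M) z -> z = 0.
  move=> /spectral_radius_ub; rewrite rho0 => z0.
  by apply: Normc.eq0_normc; apply/eqP; rewrite eq_le z0 normc_ge0.
have [d Md] : exists d, M ^+ d = 0.
  case: k V A rho0 e eB @M eig0 => V A _ e _ M eig0.
    exact: (eigenvalue0_nilpotent _ _ (real_complex R) _ M).
  exact: (eigenvalue0_nilpotent _ _ idfun _ M).
exists d => v; apply/eqP; rewrite -(passmx.rVof_eq0 eB).
suff -> : passmx.rVof e (iter d A v) = passmx.rVof e v *m M ^+ d.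
  by rewrite Md mulmx0.
elim: d {Md} => [|d IH]; first by rewrite expr0 mulmx1.
by rewrite iterS (passmx.rVof_app _ eB) IH exprSr mulmxA.
Qed.

End Nilpotency.

(** * The dynamics modulo a subspace *)

Section Dynamics.
Context {F : numFieldType} {g : lieAlgType F} {n r : nat}.
Implicit Types (B U T : {vspace g}) (x : {ffun 'I_n -> g}).

(** Used for the words [:: inl j], so that a single stage of the exhaustion
    already contains the whole linear part. *)
Lemma exhaustion_seq (K : choiceType) (S : nat -> {fset K}) (s : seq K) :
    (forall N M, (N <= M)%N -> (S N `<=` S M)%fset) ->
    (forall w, exists N, w \in S N) ->
  exists N0, forall N, (N0 <= N)%N -> {subset s <= S N}.
Proof.
move=> Smono Sex; elim: s => [|w s [N0 IH]]; first by exists 0%N.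
have [N1 wN1] := Sex w; exists (maxn N0 N1) => N.
rewrite geq_max => /andP[N0N N1N] v.
rewrite inE => /predU1P[->|]; last exact: IH.
exact: (fsubsetP (Smono _ _ N1N)).
Qed.

(** Once a partial sum contains all words [:: inl j], these contribute exactly
    the linear part, the other words of length at most one cancel in the
    difference, and the longer ones contribute elements of [T]. *)
Lemma lie_function_linear_mod B U T
    (c : seq (letter n r) -> {ffun 'I_n -> F}) f x (w : {ffun 'I_r -> g}) i :
    lie_function c f ->
    (lieV B B <= B)%VS -> (U <= B)%VS -> (T <= U)%VS -> (lieV U B <= T)%VS ->
    (forall j, x j \in U) -> (forall j, w j \in B) ->
  f x w i - f 0 w i - state_linear_fun c x i \in T.
Proof.
move=> /(_ i)[S [Smono Sex Scvg]] BB UB TU UBT xU wB.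
pose Y := letter_eval x w; pose Y' := letter_eval (0 : {ffun 'I_n -> g}) w.
have YB l : Y l \in B by case: l => j; [exact: (subvP UB _ (xU j)) | exact: wB].
have Y'B l : Y' l \in B.
  by case: l => j; rewrite /Y'/= ?ffunE; [exact: mem0v | exact: wB].
have YY' l : Y l - Y' l \in U.
  by case: l => j; rewrite /Y /Y'/= ?ffunE ?subr0 ?subrr ?mem0v.
pose s := [seq [:: inl j : letter n r] | j <- enum 'I_n].
have s_uniq : uniq s by rewrite map_inj_uniq ?enum_uniq// => j j' [].
have [N0 sS] := exhaustion_seq _ S s Smono Sex.
apply: (cvg_coord_coset T _ _ _ N0 (cvg_coordB _ _ _ _ (Scvg x w) (Scvg 0 w))).
move=> N /sS {}sS; rewrite -sumrB (bigID (mem s))/=.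
rewrite -big_filter (perm_big s)/=; last first.
  apply: uniq_perm; rewrite ?filter_uniq ?fset_uniq// => v.
  by rewrite mem_filter; case: (boolP (v \in s)) => //= /sS.
rewrite big_map big_enum/= ffunE.
under eq_bigr do rewrite ffunE scaler0 subr0.
rewrite addrC addrK; apply: rpred_sum => v vs.
rewrite -scalerBr rpredZ//.
case: v vs => [|[j|j] [|l v]] vs /=; rewrite ?subrr ?mem0v//.
- by move: vs; rewrite map_f// mem_enum.
- exact: (word_eval_diff_mem B U T Y Y' [:: inl j, l & v]).
- exact: (word_eval_diff_mem B U T Y Y' [:: inr j, l & v]).
Qed.

(** As linear combinations of components preserve both [U] and [T], the
    trajectory stays in [U] and follows the iterates of the linear part modulo
    [T]; after [d] steps these iterates vanish. *)
Lemma nilpotent_mod_reach T U (c : seq (letter n r) -> {ffun 'I_n -> F})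
    (X : nat -> {ffun 'I_n -> g}) t d :
    (T <= U)%VS -> (forall x, iter d (state_linear_fun c) x = 0) ->
    (forall s, (forall j, X s j \in U) ->
       forall j, X s.+1 j - state_linear_fun c (X s) j \in T) ->
    (forall j, X t j \in U) ->
  forall j, X (d + t)%N j \in T.
Proof.
move=> TU Ad XT XtU.
have linT (V : {vspace g}) x :
    (forall j, x j \in V) -> forall j, state_linear_fun c x j \in V.
  by move=> xV j; rewrite ffunE; apply: rpred_sum => j' _; rewrite rpredZ.
suff H s j : (X (s + t)%N j \in U) /\
    X (s + t)%N j - iter s (state_linear_fun c) (X t) j \in T.
  by move=> j; have [_] := H d j; rewrite Ad ffunE subr0.
elim: s j => [|s IH] j; first by rewrite subrr mem0v.
have XsU j' : X (s + t)%N j' \in U by case: (IH j').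
have step := XT _ XsU j; rewrite addSn; split.
  rewrite -[X _ j](subrK (state_linear_fun c (X (s + t)%N) j)).
  by rewrite rpredD//; [exact: (subvP TU) | exact: linT].
rewrite iterS -[X _ j](subrK (state_linear_fun c (X (s + t)%N) j)) -addrA.
rewrite rpredD//.
have -> : state_linear_fun c (X (s + t)%N) j -
    state_linear_fun c (iter s (state_linear_fun c) (X t)) j =
    state_linear_fun c (X (s + t)%N - iter s (state_linear_fun c) (X t)) j.
  by rewrite linearB/= !ffunE.
by apply: linT => j'; rewrite !ffunE; case: (IH j').
Qed.

End Dynamics.

(** * Descent along the lower central series *)

Lemma lower_central_sub (F : fieldType) (g : lieAlgType F) (h : {vspace g}) i :
  lie_ideal h -> (lower_central h i.+1 <= lower_central h i)%VS.
Proof.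
move=> hI; elim: i => [|i IH].
  by apply/lieV_subP => u v _ vh; exact: hI.
apply/lieV_subP => u v uh vh.
have /lieV_subP := subvv (lower_central h i.+1); apply => //.
exact: (subvP IH).
Qed.

Theorem theorem5p5 (R : realType) (k : scalar_kind)
    (g : lieAlgType (scalar_field R k)) (n r : nat)
    (f : {ffun 'I_n -> g} -> {ffun 'I_r -> g} -> {ffun 'I_n -> g})
    (c : seq (letter n r) -> {ffun 'I_n -> scalar_field R k})
    (h : {vspace g})
    (X : nat -> {ffun 'I_n -> g}) (W : nat -> {ffun 'I_r -> g}) :
  (0 < n)%N -> (0 < r)%N ->
  lie_solvable g ->
  lie_function c f ->
  (* (i) *)
  (forall x : {ffun 'I_n -> g},
     (forall w : {ffun 'I_r -> g}, f x w = x) <-> x = 0) ->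
  (* (ii) *)
  lie_ideal h -> lie_nilpotent h -> (lieV fullv fullv <= h)%VS ->
  (forall (i : nat) (x : {ffun 'I_n -> g}) (w : {ffun 'I_r -> g}),
     (forall j, x j \in lower_central h i) ->
     forall j, f x w j \in lower_central h i) ->
  spectral_radius (state_linear_part g c) = 0 ->
  (forall t j, W t j \in h) ->
  (forall t, X t.+1 = f (X t) (W t)) ->
  exists tbar : nat, forall t, (tbar <= t)%N -> X t = 0.
Proof.
move=> _ _ _ cf equil hI [p hp] ggh _ rho0 Wh Xf.
have f0 w : f 0 w = 0 by apply: (proj2 (equil 0)).
have [d Ad] : exists d, forall x, iter d (state_linear_fun (g := g) c) x = 0.
  have [d Ad] := spectral_radius0_nilpotent _ _ _ rho0.
  exists d => x; rewrite -[RHS](Ad x).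
  by elim: {Ad} d => //= d <-; rewrite /state_linear_part lfunE.
have reach B U T t : (lieV B B <= B)%VS -> (U <= B)%VS -> (T <= U)%VS ->
    (lieV U B <= T)%VS -> (h <= B)%VS -> (forall j, X t j \in U) ->
    forall j, X (d + t)%N j \in T.
  move=> BB UB TU UBT hB XtU.
  apply: (nilpotent_mod_reach T U c X t d TU Ad _ XtU) => s XsU j.
  rewrite Xf; have := lie_function_linear_mod B U T c f (X s) (W s) j cf.
  move=> /(_ BB UB TU UBT XsU).
  by rewrite f0 [(0 : {ffun _}) j]ffunE subr0; apply => j'; exact: (subvP hB).
have hh : (lieV h h <= h)%VS by apply/lieV_subP => u v _ vh; exact: hI.
have lowh i : (lower_central h i <= h)%VS.
  by elim: i => // i IH; apply: subv_trans IH; exact: lower_central_sub.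
have Xlow i : exists t, forall j, X t j \in lower_central h i.
  elim: i => [|i [t XtU]].
    exists (d + 0)%N; apply: (reach fullv fullv) => //; try exact: subvf.
    by move=> j; exact: memvf.
  exists (d + t)%N; apply: (reach h (lower_central h i)) => //.
  exact: lower_central_sub.
have [t0 Xt0] := Xlow p; exists t0 => t /subnKC <-.
elim: (t - t0)%N => [|s IH].
  rewrite addn0; apply/ffunP => j; rewrite ffunE; apply/eqP.
  by rewrite -memv0 -hp.
by rewrite addnS Xf IH f0.
Qed.
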